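(* Consider the networked load tap-changer (LTC) system $\dot r_i=\frac{1}{T_i}\left(V_{s,i}(\mathbf r)-V_{0,i}\right)$, $i\in\mathcal V_L=\{1,\dots,n\}$, on $\mathbb R^n_{>0}$, described in the context, with $\mathcal P=\{\mathbf r\in\mathbb R^n_{>0}: V_{s,i}(\mathbf r)\ge V_{0,i}\ \forall i\in\mathcal V_L\}$ nonempty and $\boldsymbol\alpha$ the largest element of $\mathcal P$. Assume that the set $\mathcal M$ of positive equilibria is a discrete set. Then every equilibrium $\mathbf r^*\in\mathcal M$ with $\mathbf r^*\neq\boldsymbol\alpha$ is unstable.
   Context: Network. Let $\mathcal G=(\mathcal V,\mathcal E)$ be a connected undirected graph with vertex set $\mathcal V=\mathcal V_L\cup\mathcal V_G$, where $\mathcal V_L=\{1,\dots,n\}$ (load buses) and $\mathcal V_G=\{n+1,\dots,n+m\}$ (generator buses), $n,m\ge1$. The subgraph induced by $\mathcal V_L$ is connected. Each line $(i,k)\in\mathcal E$ has susceptance $b_{ik}=b_{ki}>0$, and $b_{ik}=0$ if $(i,k)\notin\mathcal E$. Each load bus $i$ has secondary-side load susceptance $b_{s,i}>0$, set-point voltage $V_{0,i}>0$, and time constant $T_i>0$. The generator voltages $\mathbf V_G$ form a fixed vector with positive entries. Voltages. For tap ratios $\mathbf r\in\mathbb R^n_{>0}$ put $b_i=b_{s,i}/r_i^2$. Define the susceptance matrix $\mathbf B\in\mathbb R^{(n+m)\times(n+m)}$ by $B_{ik}=-b_{ik}$ for $i\ne k$, $B_{ii}=\sum_{k}b_{ik}$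 for $i>n$, and $B_{ii}=b_i+\sum_k b_{ik}$ for $i\le n$. Let $\mathbf B_{LL}$ (depending on $\mathbf r$) and $\mathbf B_{LG}$ be the blocks with rows in $\mathcal V_L$ and columns in $\mathcal V_L$, $\mathcal V_G$ respectively. Let $\mathbf h=-\mathbf B_{LG}\mathbf V_G\ge 0$ (constant). The matrix $\mathbf B_{LL}$ is invertible with entrywise positive inverse. The load voltages are $\mathbf V(\mathbf r)=\mathbf B_{LL}^{-1}\mathbf h$ and the secondary voltages are $V_{s,i}(\mathbf r)=V_i(\mathbf r)/r_i$. Dynamics. The LTC dynamics are $\dot r_i=\frac1{T_i}(V_{s,i}(\mathbf r)-V_{0,i})$ for all $i\in\mathcal V_L$. The set of positive equilibria is $\mathcal M=\{\mathbf r\in\mathbb R^n_{>0}: V_{s,i}(\mathbf r)=V_{0,i}\ \forall i\in\mathcal V_L\}$, and $\mathcal P=\{\mathbf r\in\mathbb R^n_{>0}:V_{s,i}(\mathbf r)\ge V_{0,i}\ \forall i\in\mathcal V_L\}$, so $\mathcal M\subseteq\mathcal P$. It is known that if $\mathcal P$ is nonempty, it has a largest element $\boldsymbol\alpha$ (i.e. $\boldsymbol\alpha\ge\mathbf r$ componentwise for all $\mathbf r\in\mathcal P$), and $\boldsymbol\alpha\in\mathcal M$. ''Unstable'' means not stable in the sense of Lyapunov. Standing assumption: $\mathcal M$ is a discrete set (the equilibria are finitely many and isolated). *)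

(* Defs.v *)
(* MathComp-Analysis, over an arbitrary [R : realType]. *)
From HB Require Import structures.
From mathcomp Require Import all_boot all_order all_algebra.
From mathcomp Require Import all_classical all_reals all_analysis.

Set Implicit Arguments.
Unset Strict Implicit.
Unset Printing Implicit Defensive.

Import Order.TTheory GRing.Theory Num.Theory.
Import numFieldNormedType.Exports.

Local Open Scope classical_set_scope.
Local Open Scope ring_scope.

Section Stability.
Context {R : realType} {V : normedModType R}.

(* Forward solution of x' = f(x) in D on the half-open interval [0, tau[; a
   solution on [0, +oo[ restricts to one on every such interval. *)
Definition ode_solution (D : set V) (f : V -> V) (tau : R) (x : R -> V) : Prop :=
  [/\ {within `[0, tau[, continuous x},
      forall t : R, 0 <= t < tau -> D (x t) &
      forall t : R, 0 < t < tau -> is_derive t 1 x (f (x t))].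

(* The requirement bears on every solution starting near xe, for as long as
   that solution is defined; finite intervals of existence are included. *)
Definition lyapunov_stable (D : set V) (f : V -> V) (xe : V) : Prop :=
  forall e : R, 0 < e -> exists2 d : R, 0 < d &
    forall (tau : R) (x : R -> V), ode_solution D f tau x ->
      `|x 0 - xe| < d -> forall t : R, 0 <= t < tau -> `|x t - xe| < e.

Definition unstable (D : set V) (f : V -> V) (xe : V) : Prop :=
  ~ lyapunov_stable D f xe.

End Stability.

Definition discrete_subset {T : topologicalType} (A : set T) : Prop :=
  A `<=` isolated A.

(* Buses are indexed by 'I_(n + m): load buses are the [lshift m i] with
   i : 'I_n, generator buses the [rshift n j] with j : 'I_m. *)
Record ltc_network (R : realType) (n m : nat) := LtcNetwork {
  line : rel 'I_(n + m);
  susc : 'I_(n + m) -> 'I_(n + m) -> R;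
  load_susc : 'I_n -> R;
  setpoint : 'I_n -> R;
  time_const : 'I_n -> R;
  gen_voltage : 'cV[R]_m;
  line_sym : symmetric line;
  line_irr : irreflexive line;
  line_connected : forall i k : 'I_(n + m), connect line i k;
  load_connected : forall i k : 'I_n,
    connect [rel u v : 'I_n | line (lshift m u) (lshift m v)] i k;
  susc_sym : forall i k, susc i k = susc k i;
  susc_gt0 : forall i k, line i k -> 0 < susc i k;
  susc_eq0 : forall i k, ~~ line i k -> susc i k = 0;
  load_susc_gt0 : forall i, 0 < load_susc i;
  setpoint_gt0 : forall i, 0 < setpoint i;
  time_const_gt0 : forall i, 0 < time_const i;
  gen_voltage_gt0 : forall j, 0 < gen_voltage j 0
}.

Section LTC.
Context {R : realType} {n m : nat} (N : ltc_network R n m).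
Implicit Type r : 'cV[R]_n.

Definition pos_orthant : set 'cV[R]_n := [set r | forall i, 0 < r i 0].

(* b_i = b_(s,i) / r_i ^ 2 at a load bus, 0 at a generator bus. *)
Definition shunt r (i : 'I_(n + m)) : R :=
  match fintype.split i with
  | inl l => load_susc N l / r l 0 ^+ 2
  | inr _ => 0
  end.

Definition Bmx r : 'M[R]_(n + m) :=
  \matrix_(i, k) if i == k then shunt r i + \sum_j susc N i j
                 else - susc N i k.

Definition B_LL r : 'M[R]_n := ulsubmx (Bmx r).
Definition B_LG r : 'M[R]_(n, m) := ursubmx (Bmx r).

(* Constant in r: B_LG has no diagonal entry of Bmx. *)
Definition hvec r : 'cV[R]_n := - (B_LG r *m gen_voltage N).

Definition voltage r : 'cV[R]_n := invmx (B_LL r) *m hvec r.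

Definition sec_voltage r (i : 'I_n) : R := voltage r i 0 / r i 0.

Definition ltc_field r : 'cV[R]_n :=
  \col_i ((time_const N i)^-1 * (sec_voltage r i - setpoint N i)).

Definition equilibria : set 'cV[R]_n :=
  [set r | pos_orthant r /\ forall i, sec_voltage r i = setpoint N i].

Definition Pset : set 'cV[R]_n :=
  [set r | pos_orthant r /\ forall i, setpoint N i <= sec_voltage r i].

End LTC.

Definition largest_elt {R : realType} {n : nat} (A : set 'cV[R]_n)
    (a : 'cV[R]_n) : Prop :=
  A a /\ forall r, A r -> forall i, r i 0 <= a i 0.

(* Main.v *)
Require Import Defs.
From mathcomp Require Import all_boot all_order all_algebra.
From mathcomp Require Import all_classical all_reals all_analysis.
From mathcomp Require Import measurable_realfun ring lra.
Set Implicit Arguments.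
Unset Strict Implicit.
Unset Printing Implicit Defensive.
Import Order.TTheory GRing.Theory Num.Theory.
Import numFieldNormedType.Exports.
Local Open Scope classical_set_scope.
Local Open Scope ring_scope.

(** With D = diag(V_0), the vector B_LL(r) (V(r) - D r) = h - B_LL(r) D r is a
    concave function of r, since its only nonlinear terms are -b_s V_0 / r_i.
    It vanishes at the equilibria r* <= alpha, hence is nonnegative and nonzero
    at the interior points of the segment [r*, alpha]; as B_LL^-1 is positive,
    the vector field is there positive in every coordinate.  A point moving
    slowly enough along the segment is therefore a subsolution, and it starts
    arbitrarily close to r*.  Raising r increases the voltages, so the system
    is cooperative, and alpha is a constant supersolution.  Picard iteration
    applied to the monotone right-hand side f + lam id, started at the
    subsolution, increases to a solution that stays between the two and is thus
    carried past the middle of the segment. *)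

(** * Damped scalar linear equations *)

Section Duhamel.
Context {R : realType}.
Notation mu := (@lebesgue_measure R).
Implicit Types (phi v : R -> R) (lam p tau t M : R).

Lemma is_derive_expR_scale lam t :
  is_derive t (1 : R) (fun s : R => expR (lam * s)) (lam * expR (lam * t)).
Proof.
have -> : lam * expR (lam * t) = expR (lam * t) *: (lam *: 1 : R).
  by rewrite /GRing.scale/= mulr1 mulrC.
exact: is_derive1_comp.
Qed.

Lemma expR_scale_continuous lam : continuous (fun s : R => expR (lam * s)).
Proof.
move=> s; apply: (@continuous_comp _ _ _ ( *%R lam) expR).
  exact: mulrl_continuous.
exact: continuous_expR.
Qed.

(** Integrating factor: the derivative of [expR (lam * t) * v t] is
    [expR (lam * t) * (dv t + lam * v t)], so this product is nondecreasing. Every comparison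
    between curves below reduces to this. *)
Lemma damped_ge0 lam tau v (dv : R -> R) :
  {within `[0, tau], continuous v} ->
  (forall t, t \in `]0, tau[ -> is_derive t 1 v (dv t)) ->
  (forall t, t \in `]0, tau[ -> 0 <= dv t + lam * v t) ->
  0 <= v 0 -> forall t, t \in `[0, tau] -> 0 <= v t.
Proof.
move=> vC vD v_ge v0 t; rewrite in_itv/= => /andP[t0 ttau].
pose w s := expR (lam * s) * v s.
have wD s : s \in `]0, tau[ ->
    is_derive s 1 w (expR (lam * s) * (dv s + lam * v s)).
  move=> s_in; have vDs := vD _ s_in; have eDs := is_derive_expR_scale lam s.
  apply: (is_derive_eq (is_deriveM eDs vDs)).
  by rewrite /GRing.scale/=; ring.
have wC : {within `[0, tau], continuous w}.
  move=> s; apply: (@continuousM R (subspace `[0, tau]) (fun s => expR (lam * s)) v).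
    exact: (continuous_subspaceT (@expR_scale_continuous lam)).
  exact: vC.
suff : w 0 <= w t.
  rewrite /w mulr0 expR0 mul1r => /(le_trans v0).
  by rewrite pmulr_rge0// expR_gt0.
apply: (@ger0_derive1_ndecr _ w 0 tau) => // s s_in.
  by have := wD _ s_in.
have := wD _ s_in => wDs.
by rewrite derive1E derive_val mulr_ge0 ?expR_ge0// v_ge.
Qed.

(** The solution of [x' + lam x = phi], [x 0 = p]. *)
Definition duhamel lam p phi t : R :=
  expR (- lam * t) *
    (p + \int[mu]_(s in `[0, t]) (expR (lam * s) * phi s)).

Lemma duhamel0 lam p phi : duhamel lam p phi 0 = p.
Proof.
by rewrite /duhamel mulr0 expR0 mul1r set_itv1 Rintegral_set1 addr0.
Qed.

Lemma expR_mul_integrable lam phi tau :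
  mu.-integrable `[0, tau] (EFin \o phi) ->
  mu.-integrable `[0, tau] (EFin \o (fun s => expR (lam * s) * phi s)).
Proof.
move=> phiI.
have mE : measurable_fun `[0, tau]%classic (fun s : R => expR (lam * s)).
  apply: measurable_funTS; apply: continuous_measurable_fun.
  exact: expR_scale_continuous.
have cE : compact ((fun s : R => expR (lam * s)) @` `[0, tau]).
  apply: continuous_compact; last exact: segment_compact.
  exact/continuous_subspaceT/expR_scale_continuous.
have [B [Br BP]] := @compact_bounded R R^o _ cE.
apply: (@integrableMr _ (measurableTypeR R) R mu `[0, tau]%classic (measurable_itv _) _ _ mE _ phiI).
by exists B; split => // x Bx s s_in; apply: BP => //; exists s.
Qed.

Lemma duhamel_continuous lam p phi tau : 0 <= tau ->
  mu.-integrable `[0, tau] (EFin \o phi) ->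
  {within `[0, tau], continuous (duhamel lam p phi)}.
Proof.
move=> tau0 phiI s.
apply: (@continuousM R (subspace `[0, tau]) (fun s => expR (- lam * s))).
  exact: (continuous_subspaceT (@expR_scale_continuous _)).
apply: continuousD; first exact: cst_continuous.
apply: parameterized_integral_continuous => //.
exact: expR_mul_integrable.
Qed.

(** Product rule and fundamental theorem of calculus; the two exponentials in front of [phi t]
    cancel. *)
Lemma is_derive_duhamel lam p phi tau t : t \in `]0, tau[ ->
  mu.-integrable `[0, tau] (EFin \o phi) ->
  {for t, continuous phi} ->
  is_derive t 1 (duhamel lam p phi) (phi t - lam * duhamel lam p phi t).
Proof.
rewrite in_itv/= => /andP[t0 ttau] phiI phiC.
have eD := is_derive_expR_scale (- lam) t.
have [] := @continuous_FTC1_closed R (fun s => expR (lam * s) * phi s) 0 t tau ttau.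
- exact: expR_mul_integrable.
- exact: t0.
- by apply: cvgM => //; exact: expR_scale_continuous.
move=> /derivableP + IE; rewrite -derive1E IE => ID.
apply: (is_derive_eq (is_deriveM eD (is_deriveD (is_derive_cst p t (1 : R)) ID))).
have E : expR (- lam * t) * expR (lam * t) = 1.
  by rewrite -expRD mulNr addNr expR0.
rewrite /GRing.scale/= add0r mulrA E mul1r /duhamel.
set e := expR _; set I := Rintegral _ _ _.
rewrite (_ : (cst p + _) t = p + I)//; ring.
Qed.

(** Dominated convergence with majorant [expR (lam * s) * M]. Integrability of the limit is part of
    the conclusion because the limit of the iteration is not yet known to be continuous where this
    is applied. *)
Lemma duhamel_cvg lam p (phi_ : (R -> R)^nat) phi tau M t : t \in `[0, tau] ->
  (forall k, measurable_fun `[0, tau] (phi_ k)) ->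
  (forall k s, s \in `[0, tau] -> `|phi_ k s| <= M) ->
  (forall s, s \in `[0, tau] -> phi_ k s @[k --> \oo] --> phi s) ->
  mu.-integrable `[0, tau] (EFin \o phi) /\
  duhamel lam p (phi_ k) t @[k --> \oo] --> duhamel lam p phi t.
Proof.
move=> t_in mphi phiM phi_cvg.
have mE : measurable_fun `[0, tau]%classic (fun s : R => expR (lam * s)).
  apply: measurable_funTS; apply: continuous_measurable_fun.
  exact: expR_scale_continuous.
have mlim : measurable_fun `[0, tau] phi.
  exact: (measurable_fun_cvg (h := phi_)).
have phiI : mu.-integrable `[0, tau] (EFin \o phi).
  apply: measurable_bounded_integrable => //.
    apply: compact_finite_measure; exact: segment_compact.
  exists M; split; rewrite ?num_real// => x Mx s s_in.
  apply: le_trans (ltW Mx).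
  apply: (cvgr_to_le (cvg_norm (phi_cvg _ s_in))).
  by near=> k; apply: phiM.
split=> //.
apply: cvgMl_tmp.
apply: cvgD; first exact: cvg_cst.
have sub : `[0, t]%classic `<=` `[0, tau]%classic.
  by apply: subset_itvl; move: t_in; rewrite bnd_simp in_itv/= => /andP[].
have [] := @dominated_convergence _ (measurableTypeR R) R mu `[0, t]%classic
  (measurable_itv _) (fun k s => (expR (lam * s) * phi_ k s)%:E)
  (fun s => (expR (lam * s) * phi s)%:E) (fun s => (expR (lam * s) * M)%:E).
- move=> k; apply/measurable_EFinP; apply: measurable_funM.
    exact: measurable_funS mE.
  exact: measurable_funS (mphi k).
- apply/measurable_EFinP; apply: measurable_funM.
    exact: measurable_funS mE.
  exact: measurable_funS mlim.
- apply: aeW => s s_in; apply/fine_cvgP; split; first by near=> k.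
  by apply: cvgMl_tmp; apply: phi_cvg; exact: sub.
- have cI : mu.-integrable `[0, t] (EFin \o cst M).
    apply: continuous_compact_integrable; first exact: segment_compact.
    exact/continuous_subspaceT/cst_continuous.
  exact: expR_mul_integrable.
- apply: aeW => s k s_in /=; rewrite lee_fin normrM ger0_norm ?expR_ge0//.
  by rewrite ler_wpM2l ?expR_ge0// phiM//; exact: sub.
move=> limI _ h.
have fin := @integrable_fin_num _ (measurableTypeR R) R mu _ (measurable_itv _) _ limI.
by move: h; rewrite -(fineK fin) => /fine_cvg.
Unshelve. all: by end_near. Qed.

End Duhamel.

(** * Coordinatewise convergence *)

Lemma cvg_col {R : realType} {n : nat} {T : Type} (F : set_system T)
    {FF : Filter F} (X : T -> 'cV[R]_n) (l : 'cV[R]_n) :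
  (forall i, X s i 0 @[s --> F] --> l i 0) -> X s @[s --> F] --> l.
Proof.
move=> Xl; apply/cvgrPdist_le => e e0; near=> s.
rewrite /Num.Def.normr/= mx_normrE (bigmax_le _ (ltW e0))//= => -[i j] _.
rewrite ord1 !mxE/=; move: i; near: s; apply: filter_forall => i.
exact: ((cvgrPdist_le _ _).1 (Xl i)).
Unshelve. all: by end_near. Qed.

Lemma ler_coord_norm {R : realType} {m n : nat} (x : 'M[R]_(m, n)) i j :
  `|x i j| <= `|x|.
Proof.
rewrite [leRHS]/Num.Def.normr/= mx_normrE.
exact: (le_bigmax _ (fun ij => `|x ij.1 ij.2|) (i, j)).
Qed.

Lemma cvg_coord {R : realType} {m n : nat} {T : Type} (F : set_system T)
    {FF : Filter F} (X : T -> 'M[R]_(m, n)) (l : 'M[R]_(m, n)) i j :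
  X s @[s --> F] --> l -> X s i j @[s --> F] --> l i j.
Proof.
move=> /cvgrPdist_le Xl; apply/cvgrPdist_le => e e0; near=> s.
have : `|(l - X s) i j| <= e by apply: le_trans (ler_coord_norm _ _ _) _; near: s; exact: Xl.
by rewrite !mxE.
Unshelve. all: by end_near. Qed.

(** * Monotone iteration between a subsolution and a constant supersolution *)

Section MonotoneIteration.
Context {R : realType} {n : nat}.
Variables (f : 'cV[R]_n -> 'cV[R]_n) (lam tau : R).
Variables (u du : R -> 'cV[R]_n) (b : 'cV[R]_n).

Definition order_box (a b : 'cV[R]_n) : set 'cV[R]_n :=
  [set x | forall i, a i 0 <= x i 0 <= b i 0].

Local Notation box := (order_box (u 0) b).
Local Notation mu := (@lebesgue_measure R).

Hypothesis tau_ge0 : 0 <= tau.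
Hypothesis u_cont : forall i, {within `[0, tau], continuous (fun t => u t i 0)}.
Hypothesis u_der : forall i t, t \in `]0, tau[ ->
  is_derive t (1 : R) (fun s => u s i 0) (du t i 0).
Hypothesis u_sub : forall i t, t \in `]0, tau[ -> du t i 0 <= f (u t) i 0.
Hypothesis u_box : forall t, t \in `[0, tau] -> box (u t).
Hypothesis f_b : forall i, f b i 0 <= 0.
Hypothesis f_quasimono : forall x y, box x -> box y ->
  (forall i, x i 0 <= y i 0) ->
  forall i, f x i 0 + lam * x i 0 <= f y i 0 + lam * y i 0.
Hypothesis f_cont : forall x, box x -> {for x, continuous f}.

Let g (i : 'I_n) (x : 'cV[R]_n) : R := f x i 0 + lam * x i 0.

Let g_cvg T (F : set_system T) (FF : Filter F) (X : T -> 'cV[R]_n) l i :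
  box l -> (forall j, X s j 0 @[s --> F] --> l j 0) ->
  g i (X s) @[s --> F] --> g i l.
Proof.
move=> lbox Xl; apply: cvgD; last exact: cvgMl_tmp.
apply: (@cvg_coord _ _ _ _ _ _ (fun s => f (X s))).
exact: cvg_comp (cvg_col Xl) (f_cont lbox).
Qed.

Let u0_box : box (u 0).
Proof. by apply: u_box; rewrite in_itv/= lexx. Qed.

Let b_box : box b.
Proof. by move=> i; rewrite lexx andbT; have /andP[] := u0_box i => /le_trans; apply. Qed.

(** The curves to which the Picard map is applied: in the box [f] is continuous and [f + lam id] is
    monotone, so the Duhamel integrand is continuous. *)
Let tame (x : R -> 'cV[R]_n) :=
  (forall i, {within `[0, tau], continuous (fun t => x t i 0)}) /\
  (forall t, t \in `[0, tau] -> box (x t)).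

Let g_tame x i : tame x -> {within `[0, tau], continuous (fun t => g i (x t))}.
Proof.
move=> [xC xb]; apply/subspace_continuousP => t t_in.
apply: g_cvg => [|j]; first exact: xb.
by have /subspace_continuousP := xC j; apply.
Qed.

Let g_tame_integrable x i : tame x ->
  mu.-integrable `[0, tau] (EFin \o (fun t => g i (x t))).
Proof.
move=> xt; apply: continuous_compact_integrable; first exact: segment_compact.
exact: g_tame.
Qed.

(** Adding [lam x] to both sides of [x' = f x] makes the right-hand side monotone; a fixed point of
    this map solves the original equation. *)
Definition picard (x : R -> 'cV[R]_n) (t : R) : 'cV[R]_n :=
  \col_i duhamel lam (u 0 i 0) (fun s => f (x s) i 0 + lam * x s i 0) t.

Let picardE x t i : picard x t i 0 = duhamel lam (u 0 i 0) (fun s => g i (x s)) t.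
Proof. by rewrite mxE. Qed.

Let picard_cont x i : tame x ->
  {within `[0, tau], continuous (fun t => picard x t i 0)}.
Proof.
move=> xt.
have -> : (fun t => picard x t i 0) = duhamel lam (u 0 i 0) (fun s => g i (x s)).
  by apply/funext => t; rewrite picardE.
apply: duhamel_continuous => //; exact: g_tame_integrable.
Qed.

Let picard_der x i t : tame x -> t \in `]0, tau[ ->
  is_derive t (1 : R) (fun s => picard x s i 0) (g i (x t) - lam * picard x t i 0).
Proof.
move=> xt t_in.
have -> : (fun t => picard x t i 0) = duhamel lam (u 0 i 0) (fun s => g i (x s)).
  by apply/funext => s; rewrite picardE.
rewrite picardE; apply: (is_derive_duhamel _ _ t_in); first exact: g_tame_integrable.
have tau0 : 0 < tau by move: t_in; rewrite in_itv/= => /andP[]; exact: lt_trans.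
exact: (within_continuous_continuous tau0 (g_tame xt) t_in).
Qed.

Let within_contB (v w : R -> R) : {within `[0, tau], continuous v} ->
  {within `[0, tau], continuous w} -> {within `[0, tau], continuous (v \- w)}.
Proof. by move=> vC wC s; apply: continuousB; [exact: vC|exact: wC]. Qed.

Let oo_cc t : t \in `]0, tau[ -> t \in `[0, tau].
Proof. exact: subset_itv_oo_cc. Qed.

(** For [v = picard x - u], [v' + lam v = g x - lam u - du >= g u - lam u - du = f u - du >= 0]. *)
Let picard_ge_u x : tame x ->
  (forall t, t \in `[0, tau] -> forall i, u t i 0 <= x t i 0) ->
  forall t, t \in `[0, tau] -> forall i, u t i 0 <= picard x t i 0.
Proof.
move=> xt ux t t_in i; rewrite -subr_ge0.
apply: (@damped_ge0 R lam tau (fun s => picard x s i 0 - u s i 0)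
  (fun s => g i (x s) - lam * picard x s i 0 - du s i 0)) t_in.
- by apply: within_contB => //; exact: picard_cont.
- by move=> s s_in; apply: is_deriveB; [exact: picard_der|exact: u_der].
- move=> s s_in.
  have := f_quasimono (u_box (oo_cc s_in)) (xt.2 _ (oo_cc s_in)) (ux _ (oo_cc s_in)) i.
  have := u_sub i s_in; rewrite /g; lra.
- by rewrite picardE duhamel0 subrr.
Qed.

(** For [v = b - picard x], [v' + lam v = lam b - g x >= lam b - g b = - f b >= 0]. *)
Let picard_le_b x : tame x ->
  forall t, t \in `[0, tau] -> forall i, picard x t i 0 <= b i 0.
Proof.
move=> xt t t_in i; rewrite -subr_ge0.
apply: (@damped_ge0 R lam tau (fun s => b i 0 - picard x s i 0)
  (fun s => 0 - (g i (x s) - lam * picard x s i 0))) t_in.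
- apply: within_contB; last exact: picard_cont.
  exact/continuous_subspaceT/cst_continuous.
- by move=> s s_in; apply: is_deriveB; exact: picard_der.
- move=> s s_in.
  have xb : forall j, x s j 0 <= b j 0.
    by move=> j; have /andP[] := xt.2 _ (oo_cc s_in) j.
  have := f_quasimono (xt.2 _ (oo_cc s_in)) b_box xb i.
  have := f_b i; rewrite /g; lra.
- by rewrite picardE duhamel0 subr_ge0; have /andP[] := u0_box i.
Qed.

Let picard_mono x y : tame x -> tame y ->
  (forall t, t \in `[0, tau] -> forall i, x t i 0 <= y t i 0) ->
  forall t, t \in `[0, tau] -> forall i, picard x t i 0 <= picard y t i 0.
Proof.
move=> xt yt xy t t_in i; rewrite -subr_ge0.
apply: (@damped_ge0 R lam tau (fun s => picard y s i 0 - picard x s i 0)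
  (fun s => (g i (y s) - lam * picard y s i 0) - (g i (x s) - lam * picard x s i 0))) t_in.
- by apply: within_contB => //; exact: picard_cont.
- by move=> s s_in; apply: is_deriveB; exact: picard_der.
- move=> s s_in.
  have := f_quasimono (xt.2 _ (oo_cc s_in)) (yt.2 _ (oo_cc s_in)) (xy _ (oo_cc s_in)) i.
  rewrite /g; lra.
- by rewrite !picardE !duhamel0 subrr.
Qed.

Let u_tame : tame u.
Proof. by []. Qed.

Let picard_tame x : tame x ->
  (forall t, t \in `[0, tau] -> forall i, u t i 0 <= x t i 0) -> tame (picard x).
Proof.
move=> xt ux; split=> [i|t t_in i]; first exact: picard_cont.
rewrite picard_le_b// andbT; apply: le_trans (picard_ge_u xt ux t_in i).
by have /andP[] := u_box t_in i.
Qed.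

Let x_ k := iter k picard u.

Let x_tame k : tame (x_ k) /\
  (forall t, t \in `[0, tau] -> forall i, u t i 0 <= x_ k t i 0).
Proof.
elim: k => [|k [xt ux]]; first by split.
by split; [exact: picard_tame|exact: picard_ge_u].
Qed.

Let x_nd k t i : t \in `[0, tau] -> x_ k t i 0 <= x_ k.+1 t i 0.
Proof.
elim: k t i => [|k IH] t i t_in; first exact: picard_ge_u.
have [xt ux] := x_tame k; have [xt1 ux1] := x_tame k.+1.
by apply: (picard_mono xt xt1) => // s s_in j; exact: IH.
Qed.

Let xlim (t : R) : 'cV[R]_n := \col_i limn (fun k => x_ k t i 0).

Let x_cvg t i : t \in `[0, tau] -> x_ k t i 0 @[k --> \oo] --> xlim t i 0.
Proof.
move=> t_in; rewrite mxE.
apply: (@nondecreasing_is_cvgn _ (fun k => x_ k t i 0)).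
  by apply/nondecreasing_seqP => k; exact: x_nd.
exists (b i 0) => _ [k _ <-].
by have [[_ /(_ _ t_in i)/andP[]]] := x_tame k.
Qed.

Let xlim_box t : t \in `[0, tau] -> box (xlim t).
Proof.
move=> t_in i; apply/andP; split.
  have h := @x_cvg t i t_in.
  apply: (cvgr_to_ge h); near=> k.
  by have [[_ /(_ _ t_in i)/andP[]]] := x_tame k.
apply: (cvgr_to_le (@x_cvg t i t_in)); near=> k.
by have [[_ /(_ _ t_in i)/andP[]]] := x_tame k.
Unshelve. all: by end_near. Qed.

(** Pass to the limit in [x_ k.+1 = picard (x_ k)]. By monotonicity [g i (x_ k)] stays between its
    values at the corners [u 0] and [b] of the box, which gives a constant majorant. *)
Let g_xlim i : mu.-integrable `[0, tau] (EFin \o (fun t => g i (xlim t))) /\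
  forall t, t \in `[0, tau] -> xlim t i 0 = picard xlim t i 0.
Proof.
have bound k s : s \in `[0, tau] -> `|g i (x_ k s)| <= `|g i (u 0)| + `|g i b|.
  move=> s_in; have [[_ /(_ _ s_in) xb] ux] := x_tame k.
  have := f_quasimono xb b_box (fun j => proj2 (andP (xb j))) i.
  have := f_quasimono u0_box xb (fun j => proj1 (andP (xb j))) i.
  rewrite -/(g _ _) -/(g _ _) -/(g _ _) => h1 h2.
  rewrite ler_norml.
  have := ler_norm (g i b); have := ler_norm (- g i (u 0)); rewrite normrN.
  have := normr_ge0 (g i b); have := normr_ge0 (g i (u 0)).
  move=> *; apply/andP; split; lra.
have H t (t_in : t \in `[0, tau]) := @duhamel_cvg R lam (u 0 i 0)
  (fun k s => g i (x_ k s)) (fun s => g i (xlim s)) tau _ t t_in.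
have {}H t (t_in : t \in `[0, tau]) : mu.-integrable `[0, tau] (EFin \o (fun t => g i (xlim t))) /\
  picard (x_ k) t i 0 @[k --> \oo] --> picard xlim t i 0.
  rewrite picardE (_ : (fun k => picard (x_ k) t i 0) =
    (fun k => duhamel lam (u 0 i 0) (fun s => g i (x_ k s)) t)); last first.
    by apply/funext => k; rewrite picardE.
  apply: H => //.
  - move=> k; apply: subspace_continuous_measurable_fun => //.
    by apply: g_tame; have [] := x_tame k.
  - by move=> k s s_in; exact: bound.
  - by move=> s s_in; apply: g_cvg => [|j]; [exact: xlim_box|exact: x_cvg].
split=> [|t t_in]; first by have [] := H 0 _; rewrite ?in_itv/= ?lexx.
have [_ h] := H t t_in.
apply: (cvg_unique _ _ h) => //.
by have := @x_cvg t i t_in; rewrite -(cvg_shiftS (fun k => x_ k t i 0)).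
Qed.

Lemma monotone_iteration : exists x : R -> 'cV[R]_n,
  [/\ x 0 = u 0, ode_solution box f tau x &
    forall t, t \in `[0, tau] -> forall i, u t i 0 <= x t i 0].
Proof.
exists (picard xlim).
have xlimE t : t \in `[0, tau] -> xlim t = picard xlim t.
  by move=> t_in; apply/colP => i; exact: (g_xlim i).2.
have xlimC i : {within `[0, tau], continuous (fun t => picard xlim t i 0)}.
  have -> : (fun t => picard xlim t i 0) = duhamel lam (u 0 i 0) (fun s => g i (xlim s)).
    by apply/funext => t; rewrite picardE.
  by apply: duhamel_continuous => //; exact: (g_xlim i).1.
(* Regularity bootstrap: [xlim], a pointwise limit, agrees on the interval with the Duhamel formula,
   which is continuous. Its integrand is then continuous too, so the formula can be
   differentiated. *)
have xlim_tame : tame xlim.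
  split=> [i|]; last exact: xlim_box.
  apply/subspace_continuousP => t t_in.
  have h : picard xlim s i 0 @[s --> within `[0, tau] (nbhs t)] --> xlim t i 0.
    by rewrite xlimE//; have /subspace_continuousP := xlimC i; apply.
  apply: cvg_trans h; apply: near_eq_cvg; near=> s.
  suff : xlim s = picard xlim s by move/(congr1 (fun v : 'cV[R]_n => v i 0)) => /esym.
  apply: xlimE.
  by near: s; exact: withinT.
split.
- by apply/colP => i; rewrite picardE duhamel0.
- split.
  + apply/subspace_continuousP => t t_in; apply: cvg_col => i.
    have sub : `[0, tau[ `<=` `[0, tau] by apply: subset_itvl; rewrite bnd_simp.
    by have /subspace_continuousP := continuous_subspaceW sub (@xlimC i); apply.
  + move=> t /andP[t0 ttau].
    have t_in : t \in `[0, tau] by rewrite in_itv/= t0 ltW.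
    by rewrite -xlimE//; exact: xlim_box.
  + move=> t t_in; have t_cc : t \in `[0, tau] by apply: oo_cc; rewrite in_itv.
    have D i := picard_der i xlim_tame t_in.
    have dX : derivable (picard xlim) t 1.
      by apply/derivable_mxP => i j; rewrite ord1; have [] := D i.
    apply: DeriveDef => //; rewrite derive_mx//; apply/colP => i.
    have Di := D i; rewrite mxE.
    by rewrite [LHS](@derive_val _ _ _ _ _ _ _ Di) -xlimE// /g; ring.
- move=> t t_in i; rewrite -xlimE//.
  have h := @x_cvg t i t_in.
  apply: (cvgr_to_ge h); near=> k.
  by have [_] := x_tame k; apply.
Unshelve. all: by end_near. Qed.

End MonotoneIteration.

(** * Continuity of the determinant and of the inverse *)

Lemma cvg_det {R : realType} {n : nat} {T : Type} (F : set_system T)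
    {FF : Filter F} (X : T -> 'M[R]_n) (A : 'M[R]_n) :
  (forall i j, X s i j @[s --> F] --> A i j) ->
  \det (X s) @[s --> F] --> \det A.
Proof.
move=> XA; apply: cvg_big => [|p _]; first exact: add_continuous.
apply: cvgMl_tmp; apply: cvg_big => [|i _]; first exact: mul_continuous.
exact: XA.
Qed.

Lemma cvg_invmx {R : realType} {n : nat} {T : Type} (F : set_system T)
    {FF : Filter F} (X : T -> 'M[R]_n) (A : 'M[R]_n) :
  (forall i j, X s i j @[s --> F] --> A i j) -> A \in unitmx ->
  forall i j, invmx (X s) i j @[s --> F] --> invmx A i j.
Proof.
move=> XA A_unit i j.
have detA : \det A != 0 by move: A_unit; rewrite unitmxE unitfE.
have Xdet : \det (X s) @[s --> F] --> \det A by exact: cvg_det.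
have h : (\det (X s))^-1 * \adj (X s) i j @[s --> F] --> invmx A i j.
  rewrite /invmx A_unit !mxE; apply: cvgM; first exact: (cvgV detA Xdet).
  under eq_fun do rewrite mxE.
  apply: cvgMl_tmp; apply: cvg_det => k l; rewrite !mxE.
  by under eq_fun do rewrite !mxE; exact: XA.
(* On a singular matrix [invmx] returns the matrix itself, so the cofactor formula holds only near
   the limit, where the determinant is nonzero. *)
apply: cvg_trans h; apply: near_eq_cvg; near=> s.
have detX : \det (X s) != 0 by near: s; exact: (cvgr_neq0 (V := R) _ Xdet detA).
by rewrite /invmx unitmxE unitfE detX !mxE.
Unshelve. all: by end_near. Qed.

Lemma colBE {V : zmodType} {n : nat} (x y : 'cV[V]_n) i :
  (x - y) i 0 = x i 0 - y i 0.
Proof. by rewrite !mxE. Qed.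

(** * The load-bus matrix and the positivity of its inverse *)

Section Network.
Context {R : realType} {n m : nat} (N : ltc_network R n m).
Implicit Types (r v : 'cV[R]_n) (i k : 'I_n).

Local Notation w i k := (susc N (lshift m i) (lshift m k)).
Local Notation gsusc i := (\sum_(j < m) susc N (lshift m i) (rshift n j)).

Lemma susc_ge0 (x y : 'I_(n + m)) : 0 <= susc N x y.
Proof.
have [l|l] := boolP (line N x y); first exact/ltW/susc_gt0.
by rewrite susc_eq0.
Qed.

(** The part of [B_LL] independent of the tap ratios: the weighted Laplacian of the load subgraph
    plus the diagonal of line susceptances to the generators. *)
Definition coupling v i : R := \sum_k w i k * (v i 0 - v k 0) + gsusc i * v i 0.

Lemma B_LL_mulE r v i :
  (B_LL N r *m v) i 0 = load_susc N i / r i 0 ^+ 2 * v i 0 + coupling v i.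
Proof.
have offdiag : \sum_(k | k != i) B_LL N r i k * v k 0 =
    - \sum_(k | k != i) w i k * v k 0.
  rewrite -sumrN; apply: eq_bigr => k ki.
  by rewrite !mxE (inj_eq (@lshift_inj _ _)) eq_sym (negbTE ki) mulNr.
rewrite mxE (bigD1 i)//= offdiag !mxE eqxx.
rewrite /shunt (unsplitK (inl i : _ + _)) big_split_ord/= /coupling.
rewrite (bigD1 i)//= [in RHS](bigD1 i)//= subrr mulr0 add0r.
(* The diagonal entry of [Bmx] sums over all buses, including the bus itself; that self-term
   vanishes as there are no loops. *)
rewrite susc_eq0 ?line_irr// add0r.
rewrite [in RHS](eq_bigr (fun k => w i k * v i 0 - w i k * v k 0)); last first.
  by move=> k _; rewrite mulrBr.
by rewrite sumrB -mulr_suml; ring.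
Qed.

(** Minimum principle: at an index where [v] is minimal the coupling differences are nonpositive, so
    a negative minimum would make that row negative through the shunt term. *)
Lemma B_LL_ge0 r v : pos_orthant r ->
  (forall i, 0 <= (B_LL N r *m v) i 0) -> forall i, 0 <= v i 0.
Proof.
move=> r0 Bv i.
have [k0 _ kmin] := @arg_minP _ R 'I_n i xpredT (fun k => v k 0) isT.
apply: le_trans (kmin i isT); rewrite leNgt; apply/negP => vk.
have := Bv k0; rewrite B_LL_mulE leNgt => /negP; apply.
rewrite ltr_wnDr//; last first.
  by rewrite pmulr_rlt0// divr_gt0 ?load_susc_gt0// exprn_gt0.
rewrite /coupling -oppr_ge0 opprD addr_ge0//; last first.
  by rewrite -mulrN mulr_ge0 ?oppr_ge0 ?(ltW vk)// sumr_ge0// => j _; exact: susc_ge0.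
rewrite -sumrN sumr_ge0// => k _; rewrite -mulrN opprB mulr_ge0 ?susc_ge0//.
by rewrite subr_ge0 kmin.
Qed.

(** Strong minimum principle: where [v] vanishes, the row is minus a weighted sum of the
    neighbouring values, so these vanish too. Connectedness of the load subgraph carries the zero to
    [k0], where the row could then not be positive. *)
Lemma B_LL_gt0 r v k0 : pos_orthant r ->
  (forall i, 0 <= (B_LL N r *m v) i 0) -> 0 < (B_LL N r *m v) k0 0 ->
  forall i, 0 < v i 0.
Proof.
move=> r0 Bv Bvk0.
have v0 := B_LL_ge0 r0 Bv.
have BvE k : v k 0 = 0 -> (B_LL N r *m v) k 0 = - \sum_l w k l * v l 0.
  move=> vk; rewrite B_LL_mulE /coupling vk !mulr0 add0r addr0 -sumrN.
  by apply: eq_bigr => l _; rewrite sub0r mulrN.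
have wv k l : 0 <= w k l * v l 0 by rewrite mulr_ge0 ?susc_ge0.
have step k l : line N (lshift m k) (lshift m l) -> v k 0 = 0 -> v l 0 = 0.
  move=> kl vk; have := Bv k; rewrite BvE// oppr_ge0 => sum_le0.
  have sum0 : \sum_l w k l * v l 0 = 0.
    by apply: le_anti; rewrite sum_le0 sumr_ge0.
  have := psumr_eq0P (fun l _ => wv k l) sum0 isT (i := l).
  by move/eqP; rewrite mulf_eq0 (gt_eqF (susc_gt0 kl))/= => /eqP.
move=> i; rewrite lt_neqAle v0 andbT eq_sym; apply/eqP => vi.
have vk0 : v k0 0 = 0.
  have /connectP[p + ->] := load_connected N i k0.
  elim: p i vi => //= l p IH i vi /andP[il]; apply: IH; exact: step il vi.
by move: Bvk0; rewrite BvE// oppr_gt0 ltNge sumr_ge0.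
Qed.

(** The minimum principle applied to a kernel vector and to its opposite. Row freeness concerns
    multiplication from the left, hence the transposes. *)
Lemma B_LL_unit r : pos_orthant r -> B_LL N r \in unitmx.
Proof.
move=> r0; rewrite -unitmx_tr -row_free_unit; apply: inj_row_free => v.
move=> /(congr1 trmx); rewrite trmx_mul trmxK trmx0 => Bv.
have vT_ge0 i : 0 <= v^T i 0 by apply: (B_LL_ge0 r0) => k; rewrite Bv mxE.
have vT_le0 i : 0 <= (- v^T) i 0.
  by apply: (B_LL_ge0 r0) => k; rewrite mulmxN Bv oppr0 mxE.
apply: trmx_inj; apply/colP => i; rewrite trmx0 [RHS]mxE; apply: le_anti.
by rewrite vT_ge0 andbT; move: (vT_le0 i); rewrite mxE oppr_ge0.
Qed.

(** * Load voltages and their monotonicity *)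

Lemma hvecE r i : hvec N r i 0 =
  \sum_(j < m) susc N (lshift m i) (rshift n j) * gen_voltage N j 0.
Proof.
rewrite !mxE -sumrN; apply: eq_bigr => j _; rewrite !mxE.
by rewrite eq_lrshift mulNr opprK.
Qed.

Lemma B_LL_voltage r : pos_orthant r -> B_LL N r *m voltage N r = hvec N r.
Proof. by move=> r0; rewrite /voltage mulKVmx// B_LL_unit. Qed.

Lemma voltageE r i : pos_orthant r ->
  load_susc N i / r i 0 ^+ 2 * voltage N r i 0 + coupling (voltage N r) i =
  \sum_(j < m) susc N (lshift m i) (rshift n j) * gen_voltage N j 0.
Proof. by move=> r0; rewrite -B_LL_mulE B_LL_voltage// hvecE. Qed.

Lemma voltage_ge0 r i : pos_orthant r -> 0 <= voltage N r i 0.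
Proof.
move=> r0; apply: (B_LL_ge0 r0) => {}i; rewrite B_LL_voltage// hvecE sumr_ge0//.
by move=> j _; rewrite mulr_ge0 ?susc_ge0// ltW// gen_voltage_gt0.
Qed.

Lemma couplingB v v' i : coupling (v - v') i = coupling v i - coupling v' i.
Proof.
rewrite /coupling (eq_bigr (fun k => w i k * (v i 0 - v k 0) - w i k * (v' i 0 - v' k 0))).
  by rewrite sumrB !mxE; ring.
by move=> k _; rewrite !mxE; ring.
Qed.

(** Raising the ratios lowers the shunts [b]: [B_LL(r') (V(r') - V(r))] has entries
    [(b_i(r) - b_i(r')) V_i(r) >= 0]. *)
Lemma voltage_mono r r' : pos_orthant r -> (forall i, r i 0 <= r' i 0) ->
  forall i, voltage N r i 0 <= voltage N r' i 0.
Proof.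
move=> r0 rr' i.
have r'0 : pos_orthant r' by move=> k; exact: lt_le_trans (r0 k) (rr' k).
rewrite -subr_ge0 -colBE; apply: (B_LL_ge0 r'0) => k.
rewrite B_LL_mulE couplingB colBE.
have := voltageE k r0; have := voltageE k r'0.
suff : load_susc N k / r' k 0 ^+ 2 * voltage N r k 0 <=
  load_susc N k / r k 0 ^+ 2 * voltage N r k 0 by lra.
rewrite ler_wpM2r ?voltage_ge0// ler_wpM2l//; first exact/ltW/load_susc_gt0.
by rewrite lef_pV2 ?posrE ?exprn_gt0// lerXn2r// nnegrE ltW.
Qed.

(** * The vector field: cooperativity and continuity *)

Lemma ltc_fieldE r i : ltc_field N r i 0 =
  (time_const N i)^-1 * (voltage N r i 0 / r i 0 - setpoint N i).
Proof. by rewrite mxE. Qed.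

(** Since voltages increase with the ratios, [V_i / r_i] can decrease only through its denominator,
    at a rate bounded on the box; [lam] compensates for this. *)
Lemma ltc_field_quasimono a b : pos_orthant a -> exists lam : R,
  forall x y, order_box a b x -> order_box a b y ->
    (forall i, x i 0 <= y i 0) ->
    forall i, ltc_field N x i 0 + lam * x i 0 <= ltc_field N y i 0 + lam * y i 0.
Proof.
move=> a0.
(* Bound for [V_i / (T_i x_i y_i)] on the box: largest voltage, smallest ratios. The sum of these
   nonnegative bounds serves all coordinates at once. *)
pose c i := (time_const N i)^-1 * (voltage N b i 0 / (a i 0 * a i 0)).
exists (\sum_i c i) => x y xab yab xy i.
have pos_box z : order_box a b z -> pos_orthant z.
  by move=> zab k; have /andP[az _] := zab k; exact: lt_le_trans (a0 k) az.
have b0 : pos_orthant b.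
  by move=> k; have /andP[_ xb] := xab k; exact: lt_le_trans (pos_box _ xab k) xb.
have c0 k : 0 <= c k.
  apply: mulr_ge0; first by rewrite invr_ge0 ltW// time_const_gt0.
  by apply: divr_ge0; rewrite ?voltage_ge0// mulr_ge0// ltW.
have T0 : 0 < (time_const N i)^-1 by rewrite invr_gt0 time_const_gt0.
have xi0 := pos_box _ xab i; have yi0 := pos_box _ yab i; have ai0 := a0 i.
have /andP[ax _] := xab i; have /andP[ay _] := yab i.
have c_lam : c i * (y i 0 - x i 0) <= (\sum_i c i) * (y i 0 - x i 0).
  rewrite ler_wpM2r ?subr_ge0// (bigD1 i)//= lerDl.
  by rewrite sumr_ge0.
suff : (time_const N i)^-1 * (voltage N x i 0 / x i 0) <=
    (time_const N i)^-1 * (voltage N y i 0 / y i 0) + c i * (y i 0 - x i 0).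
  rewrite !ltc_fieldE !mulrBr; move: c_lam; rewrite mulrBr; lra.
rewrite /c -mulrA -mulrDr ler_wpM2l ?(ltW T0)//.
have Vxy := voltage_mono (pos_box _ xab) xy i.
have Vxb : voltage N x i 0 <= voltage N b i 0.
  by apply: (voltage_mono (pos_box _ xab)) => k; have /andP[] := xab k.
have V0 := voltage_ge0 i (pos_box _ xab).
move: Vxy Vxb V0 (xy i) ax ay xi0 yi0 ai0.
move: (voltage N x i 0) (voltage N y i 0) (voltage N b i 0) (x i 0) (y i 0) (a i 0).
move=> Vx Vy Vb p q s VxVy VxVb Vx0 pq sp sq p0 q0 s0.
apply: (@le_trans _ _ (Vx / q + Vb / (s * s) * (q - p))); last first.
  by rewrite lerD2r ler_wpM2r// invr_ge0 ltW.
have -> : Vx / p = Vx / q + Vx / (p * q) * (q - p).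
  by field; rewrite !gt_eqF.
rewrite lerD2l ler_wpM2r ?subr_ge0//.
apply: ler_pM => //; first by rewrite invr_ge0 mulr_ge0// ltW.
rewrite lef_pV2 ?posrE ?mulr_gt0//.
by apply: ler_pM => //; exact: ltW.
Qed.

Lemma ltc_field_continuous r : pos_orthant r -> {for r, continuous (ltc_field N)}.
Proof.
move=> r0; have FF : Filter (nbhs r) by exact: nbhs_filter.
apply: (@cvg_col _ _ _ (nbhs r) _ (ltc_field N)) => i.
rewrite ltc_fieldE.
have coord k : (x : 'cV[R]_n) k 0 @[x --> r] --> r k 0.
  by exact: (@cvg_coord _ _ _ _ (nbhs r) FF id r k 0).
have Bc k l : B_LL N x k l @[x --> r] --> B_LL N r k l.
  have B_LLE x : B_LL N x k l = if lshift m k == lshift m l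
      then shunt N x (lshift m k) + \sum_j susc N (lshift m k) j
      else - susc N (lshift m k) (lshift m l) by rewrite !mxE.
  rewrite B_LLE (eq_cvg _ _ B_LLE).
  case: (lshift m k == lshift m l); last exact: cvg_cst.
  apply: cvgD; last exact: cvg_cst.
  rewrite /shunt; case: fintype.split => j; last exact: cvg_cst.
  apply: cvgMl_tmp; apply: cvgV; first by rewrite gt_eqF// exprn_gt0.
  exact: cvgM.
rewrite (eq_cvg _ _ (fun x => ltc_fieldE x i)).
apply: cvgMl_tmp; apply: cvgB; last exact: cvg_cst.
apply: cvgM; last by apply: cvgV => //; rewrite gt_eqF.
(* The source vector is constant in [x], so it is frozen at [r] and only the inverse varies. *)
have voltE x : voltage N x i 0 = \sum_j invmx (B_LL N x) i j * hvec N r j 0.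
  by rewrite mxE; apply: eq_bigr => j _; rewrite !hvecE.
rewrite voltE (eq_cvg _ _ voltE).
apply: cvg_big => [|j _]; first exact: add_continuous.
by apply: cvgMr_tmp; apply: cvg_invmx; rewrite ?B_LL_unit.
Qed.

(** If [sec_voltage N a i] exceeded its set-point, raising the [i]-th coordinate
    of [a] to [voltage N a i 0 / setpoint N i] would not leave [Pset N]. *)
Lemma largest_equilibrium a : largest_elt (Pset N) a -> equilibria N a.
Proof.
move=> [[a0 aP] a_max]; split=> // i; apply: le_anti; rewrite aP andbT.
have V0_gt0 := setpoint_gt0 N i.
pose t := voltage N a i 0 / setpoint N i.
have a_t : a i 0 <= t.
  rewrite /t ler_pdivlMr//; have := aP i; rewrite /sec_voltage ler_pdivlMr//.
  by rewrite mulrC.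
pose a' : 'cV[R]_n := \col_k if k == i then t else a k 0.
have a'E k : a' k 0 = if k == i then t else a k 0 by rewrite mxE.
have aa' k : a k 0 <= a' k 0 by rewrite a'E; case: eqP => [->|].
have a'0 : pos_orthant a' by move=> k; exact: lt_le_trans (a0 k) (aa' k).
have Va' := voltage_mono a0 aa'.
have : Pset N a'.
  split=> // k; rewrite /sec_voltage ler_pdivlMr//.
  apply: le_trans (Va' k); rewrite a'E; case: eqP => [->|_].
    by rewrite /t mulrC divfK// gt_eqF.
  by have := aP k; rewrite /sec_voltage ler_pdivlMr.
move/a_max/(_ i); rewrite a'E eqxx /t ler_pdivrMr// => h.
by rewrite /sec_voltage ler_pdivrMr// mulrC.
Qed.

(** * From the segment between two equilibria to instability *)

Lemma couplingD v v' i : coupling (v + v') i = coupling v i + coupling v' i.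
Proof.
rewrite /coupling (eq_bigr (fun k => w i k * (v i 0 - v k 0) + w i k * (v' i 0 - v' k 0))).
  by rewrite big_split/= !mxE; ring.
by move=> k _; rewrite !mxE; ring.
Qed.

Lemma couplingZ (c : R) v i : coupling (c *: v) i = c * coupling v i.
Proof.
rewrite /coupling (eq_bigr (fun k => c * (w i k * (v i 0 - v k 0)))).
  by rewrite -mulr_sumr !mxE; ring.
by move=> k _; rewrite !mxE; ring.
Qed.

(** The set-points seen from the primary side; at an equilibrium this is the voltage vector. *)
Definition primary_setpoint r : 'cV[R]_n := \col_i (setpoint N i * r i 0).

Lemma primary_setpointE r i : primary_setpoint r i 0 = setpoint N i * r i 0.
Proof. by rewrite mxE. Qed.

Lemma ltc_field_segment_gt0 r a (s : R) : equilibria N r -> equilibria N a ->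
  (forall i, r i 0 <= a i 0) -> r <> a -> 0 < s < 1 ->
  forall i, 0 < ltc_field N (r + s *: (a - r)) i 0.
Proof.
move=> [r0 r_eq] [a0 a_eq] ra /eqP r_neq_a /andP[s0 s1].
set p := r + s *: (a - r).
have pE i : p i 0 = r i 0 + s * (a i 0 - r i 0) by rewrite !mxE.
have p0 : pos_orthant p.
  by move=> i; rewrite pE ltr_wpDr// mulr_ge0 ?subr_ge0// ltW.
have eqV x : pos_orthant x -> (forall i, sec_voltage N x i = setpoint N i) ->
    voltage N x = primary_setpoint x.
  move=> x0 x_eq; apply/colP => i; rewrite [RHS]mxE -x_eq /sec_voltage divfK//.
  by rewrite gt_eqF.
have pD : primary_setpoint p =
    (1 - s) *: primary_setpoint r + s *: primary_setpoint a.
  by apply/colP => i; rewrite !mxE; ring.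
pose h i : R := \sum_(j < m) susc N (lshift m i) (rshift n j) * gen_voltage N j 0.
(* The coupling is linear and cancels, leaving the convexity gap of the inverse function: [(1 - s) /
   r + s / a - 1 / p = s (1 - s) (a - r)^2 / (r a p)]. *)
have defect i : (B_LL N p *m (voltage N p - primary_setpoint p)) i 0 =
    load_susc N i * setpoint N i *
      (s * (1 - s) * (a i 0 - r i 0) ^+ 2 / (r i 0 * a i 0 * p i 0)).
  have Br := voltageE i r0; have Ba := voltageE i a0; have Bp := voltageE i p0.
  rewrite (eqV r)// primary_setpointE in Br; rewrite (eqV a)// primary_setpointE in Ba.
  rewrite mulmxBr colBE !B_LL_mulE Bp pD couplingD !couplingZ -pD primary_setpointE.
  have -> : coupling (primary_setpoint r) i = h i - load_susc N i / r i 0 ^+ 2 * (setpoint N i * r i 0).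
    by rewrite /h -Br; ring.
  have -> : coupling (primary_setpoint a) i = h i - load_susc N i / a i 0 ^+ 2 * (setpoint N i * a i 0).
    by rewrite /h -Ba; ring.
  rewrite -/(h i).
  have := p0 i; have := r0 i; have := a0 i; rewrite !pE => ai ri pi.
  by field; rewrite !gt_eqF.
have coef_ge0 i : 0 <= load_susc N i * setpoint N i.
  by apply: mulr_ge0; rewrite ltW ?load_susc_gt0 ?setpoint_gt0.
(* One coordinate with a strict gap suffices: [B_LL_gt0] spreads strict positivity to all buses. *)
have [k rk] : exists k, r k 0 != a k 0.
  apply/existsP; apply: contraNT r_neq_a; rewrite negb_exists => /forallP ra'.
  by apply/eqP/colP => k; apply/eqP; rewrite -[_ == _]negbK ra'.
have V_gt : forall i, 0 < (voltage N p - primary_setpoint p) i 0.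
  apply: (@B_LL_gt0 p _ k p0).
    move=> i; rewrite defect mulr_ge0// divr_ge0//.
      by rewrite !mulr_ge0 ?sqr_ge0 ?subr_ge0 ?(ltW s0) ?(ltW s1).
    by rewrite !mulr_ge0 ?(ltW (r0 i)) ?(ltW (a0 i)) ?(ltW (p0 i)).
  rewrite defect; apply: mulr_gt0; first by rewrite mulr_gt0 ?load_susc_gt0 ?setpoint_gt0.
  apply: divr_gt0; last by rewrite !mulr_gt0.
  apply: mulr_gt0; first by rewrite mulr_gt0 ?subr_gt0.
  by rewrite exprn_gt0// subr_gt0 lt_neqAle rk ra.
move=> i; rewrite ltc_fieldE mulr_gt0 ?invr_gt0 ?time_const_gt0// subr_gt0.
rewrite ltr_pdivlMr//; have := V_gt i.
by rewrite colBE primary_setpointE subr_gt0.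
Qed.

(** By compactness the positive field has a positive minimum on a closed subsegment avoiding both
    equilibria, so motion along it with velocity [c *: (a - r)] is a subsolution. *)
Lemma ltc_field_segment_bound r a (s0 s1 : R) : equilibria N r -> equilibria N a ->
  (forall i, r i 0 <= a i 0) -> r <> a -> 0 < s0 -> s0 <= s1 -> s1 < 1 ->
  exists2 c : R, 0 < c & forall s, s0 <= s <= s1 -> forall i,
    c * (a - r) i 0 <= ltc_field N (r + s *: (a - r)) i 0.
Proof.
move=> r_eq a_eq ra r_neq s0_gt0 s01 s1_lt1.
pose p s : 'cV[R]_n := r + s *: (a - r).
have p0 s : s \in `[s0, s1] -> pos_orthant (p s).
  rewrite in_itv/= => /andP[s0s ss1] i.
  rewrite !mxE ltr_wpDr//; last by have [] := r_eq.
  by rewrite mulr_ge0 ?subr_ge0// (le_trans _ s0s)// ltW.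
have pC : continuous p.
  move=> s; apply: cvgD; first exact: cvg_cst.
  exact: scalel_continuous.
have fC i : {within `[s0, s1], continuous (fun s => ltc_field N (p s) i 0)}.
  apply/subspace_continuousP => s s_in.
  have ps : p t @[t --> within `[s0, s1] (nbhs s)] --> p s.
    by apply: cvg_within_filter; exact: pC.
  have fs : ltc_field N (p t) @[t --> within `[s0, s1] (nbhs s)] --> ltc_field N (p s).
    exact: (cvg_comp _ _ ps (ltc_field_continuous (p0 s s_in))).
  exact: (@cvg_coord R n 1 R _ _ (fun s => ltc_field N (p s)) _ i 0 fs).
have fmin i : exists2 e : R, 0 < e & forall s, s0 <= s <= s1 -> e <= ltc_field N (p s) i 0.
  have [s s_in smin] := EVT_min s01 (fC i).
  exists (ltc_field N (p s) i 0); last by move=> t t_in; apply: smin; rewrite in_itv.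
  apply: ltc_field_segment_gt0 => //; move: s_in; rewrite in_itv/= => /andP[s0s ss1].
  by rewrite (lt_le_trans s0_gt0 s0s) (le_lt_trans ss1 s1_lt1).
have [e e_gt0 e_le] : exists2 e : 'I_n -> R, (forall i, 0 < e i) &
    forall i s, s0 <= s <= s1 -> e i <= ltc_field N (p s) i 0.
  by exists (fun i => s2val (cid2 (fmin i))) => i; case: cid2.
(* [W] is positive and dominates every coordinate of [a - r]. *)
pose W := 1 + \sum_i (a - r) i 0.
have ar0 i : 0 <= (a - r) i 0 by rewrite colBE subr_ge0.
have W0 : 0 < W by rewrite ltr_wpDr// sumr_ge0.
exists ((\big[Order.min/1]_i e i) / W).
  by rewrite divr_gt0// lt_bigmin.
move=> s s_in i; apply: le_trans (e_le i s s_in).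
rewrite mulrAC ler_pdivrMr//.
apply: ler_pM => //; first by rewrite le_bigmin// => *; exact: ltW.
  exact: bigmin_le_cond.
by rewrite /W (bigD1 i)//= addrCA lerDl addr_ge0// sumr_ge0.
Qed.

Lemma unstable_below_equilibrium r a : equilibria N r -> equilibria N a ->
  (forall i, r i 0 <= a i 0) -> r <> a ->
  unstable (@pos_orthant R n) (ltc_field N) r.
Proof.
move=> r_eq a_eq ra r_neq stable.
have d0 : 0 < `|a - r| by rewrite normr_gt0 subr_eq0; apply/eqP => /esym.
have e0 : 0 < `|a - r| / 2 by rewrite divr_gt0.
have [d d_gt0 {}stable] := stable _ e0.
(* The start lies at distance at most [d / 2] from [r], and before the middle of the segment. *)
pose s0 := Num.min (4^-1) (d / (2 * `|a - r|)).
have s0_gt0 : 0 < s0 by rewrite lt_min invr_gt0 ltr0n divr_gt0// mulr_gt0.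
have s0_le : s0 <= 4^-1 by rewrite ge_min lexx.
have s0_d : s0 * `|a - r| < d.
  apply: (@le_lt_trans _ _ (d / 2)); last by lra.
  have : s0 <= d / (2 * `|a - r|) by rewrite ge_min lexx orbT.
  by rewrite invfM mulrA ler_pdivlMr.
have s01 : s0 <= 3 / 4 by lra.
have s1_lt1 : 3 / 4 < 1 :> R by lra.
have [c c0 c_le] := ltc_field_segment_bound r_eq a_eq ra r_neq s0_gt0 s01 s1_lt1.
pose u t : 'cV[R]_n := r + (s0 + c * t) *: (a - r).
have uE t i : u t i 0 = r i 0 + (s0 + c * t) * (a i 0 - r i 0) by rewrite !mxE.
(* The subsolution reaches parameter [3 / 4] at [tau]. Going beyond the middle matters: solutions
   live on a half-open interval, and the escape time [t1] must be smaller than [tau]. *)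
pose tau := (3 / 4 - s0) / c.
have tau_gt0 : 0 < tau by rewrite divr_gt0//; lra.
have s_in t : t \in `[0, tau] -> s0 <= s0 + c * t <= 3 / 4.
  rewrite in_itv/= => /andP[t0]; rewrite /tau ler_pdivlMr// => t_tau.
  have := mulr_ge0 (ltW c0) t0; rewrite mulrC in t_tau; lra.
have [r0 _] := r_eq; have [a0 a_sec] := a_eq.
have u0_pos : pos_orthant (u 0).
  move=> i; rewrite uE mulr0 addr0 ltr_wpDr//.
  by rewrite mulr_ge0 ?subr_ge0// ltW.
(* The lower corner is [u 0], whose positivity keeps the box away from the singularity of the field
   at zero ratios. *)
have [lam lamP] := ltc_field_quasimono a u0_pos.
have u_der i t : is_derive t (1 : R) (fun s => u s i 0) ((c *: (a - r)) i 0).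
  have -> : (fun s => u s i 0) = (fun s : R => (r i 0 + s0 * (a i 0 - r i 0)) + (c * (a i 0 - r i 0)) *: s).
    by apply/funext => s; rewrite uE /GRing.scale/=; ring.
  apply: (is_derive_eq (is_deriveD (is_derive_cst _ t (1 : R))
    (is_deriveZ _ (is_derive_id t (1 : R))))).
  by rewrite add0r [RHS]mxE colBE /GRing.scale/= mulr1.
have [] := @monotone_iteration R n (ltc_field N) lam tau u (fun=> c *: (a - r)) a.
- exact: ltW.
- move=> i; apply: derivable_within_continuous => t _.
  by have [] := u_der i t.
- by move=> i t t_in; rewrite mxE; apply: c_le; apply/s_in/subset_itv_oo_cc.
- move=> t t_in i; have /andP[s0s ss1] := s_in t t_in.
  rewrite !uE mulr0 addr0 lerD2l ler_wpM2r ?subr_ge0//=.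
  have : (s0 + c * t) * (a i 0 - r i 0) <= 1 * (a i 0 - r i 0).
    by rewrite ler_wpM2r ?subr_ge0//; lra.
  lra.
- by move=> i; rewrite ltc_fieldE [X in X - _]a_sec subrr mulr0.
- exact: lamP.
- move=> y ybox; apply: ltc_field_continuous => i.
  by have /andP[+ _] := ybox i; apply: lt_le_trans.
move=> x [x0 [xC xbox xD] ux].
have xsol : ode_solution (@pos_orthant R n) (ltc_field N) tau x.
  split=> // t t_in i; have /andP[+ _] := xbox t t_in i.
  exact: lt_le_trans.
have x0_near : `|x 0 - r| < d.
  by rewrite x0 /u mulr0 addr0 addrAC subrr add0r normrZ gtr0_norm.
pose t1 := (2^-1 - s0) / c.
have t1_in : 0 <= t1 < tau.
  rewrite divr_ge0 ?(ltW c0)//=; last lra.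
  by rewrite ltr_pM2r ?invr_gt0//; lra.
have := stable tau x xsol x0_near t1 t1_in; apply/negP; rewrite -leNgt.
(* In a coordinate attaining the sup norm, [x t1 - r >= (a - r) / 2], which contradicts stability at
   radius half of that norm. *)
have [i normE] : exists i, `|a - r| = `|(a - r) i 0|.
  have [[i j] /= normE] := @mx_norm_neq0 _ _ _ (a - r) (lt0r_neq0 d0).
  by exists i; rewrite [LHS]normE (ord1 j).
rewrite normE.
apply: le_trans (ler_coord_norm _ i 0).
have t1_cc : t1 \in `[0, tau] by rewrite in_itv/=; case/andP: t1_in => -> /ltW.
have := ux t1 t1_cc i; rewrite uE !colBE.
have -> : s0 + c * t1 = 2^-1 by rewrite /t1; field; rewrite gt_eqF.
have := ra i; rewrite -subr_ge0 => ari; rewrite (ger0_norm ari) => uxi.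
apply: le_trans (ler_norm _); lra.
Qed.

End Network.

Theorem theorem3 (R : realType) (n m : nat) (n_gt0 : (0 < n)%N)
    (m_gt0 : (0 < m)%N) (N : ltc_network R n m) (alpha : 'cV[R]_n)
    (P_nonempty : Pset N !=set0)
    (alpha_largest : largest_elt (Pset N) alpha)
    (M_discrete : discrete_subset (equilibria N))
    (r : 'cV[R]_n) (r_eq : equilibria N r) (r_neq : r <> alpha) :
  unstable (@pos_orthant R n) (ltc_field N) r.
Proof.
apply: (unstable_below_equilibrium r_eq (largest_equilibrium alpha_largest) _ r_neq).
(* An equilibrium belongs to [Pset N], hence lies below [alpha]. *)
apply: alpha_largest.2; split=> [|i]; first exact: r_eq.1.
by rewrite r_eq.2.
Qed.
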